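(* Let $X$ be a Banach space and $G$ a compact topological group acting on $X$. Let $f:X\to\mathbb{R}\cup\{+\infty\}$ be a proper, convex, $G$-invariant function that is continuous at $x_0\in\mathrm{Dom}(f)\cap X_G$. Then $$d^+f(x_0)(x)=\sup\{\operatorname{Re}\langle x^*,x\rangle : x^*\in\partial_Gf(x_0)\}\qquad\text{for all } x\in X_G.$$ Moreover, for each such $x$ this supremum is attained at some $x^*\in\partial_Gf(x_0)$.
   Context: $X$ is a Banach space over $\mathbb{K}=\mathbb{R}$ or $\mathbb{C}$ (for $\mathbb{K}=\mathbb{R}$, $\operatorname{Re}$ is the identity). A compact topological group $G$ acting on $X$ means: a group $G\subseteq\mathcal{L}(X)$ of linear isometric isomorphisms of $X$ onto itself, compact for the relative topology inherited from $\mathcal{L}(X)$. $X_G=\{x\in X: g(x)=x\ \forall g\in G\}$; $X_G^*=\{h\in X^*: h(g(x))=h(x)\ \forall x\in X, g\in G\}$. $f$ is $G$-invariant if $f(g(x))=f(x)$ for all $x\in X$, $g\in G$. $\mathrm{Dom}(f)=\{x: f(x)<+\infty\}$. The right directional derivative is $d^+f(x_0)(x)=\lim_{t\to0^+}\frac{f(x_0+tx)-f(x_0)}{t}$. The $G$-subdifferential is $\partial_Gf(x_0)=\{h\in X_G^*: \operatorname{Re}\langle h,x-x_0\rangle\le f(x)-f(x_0)\ \forall x\in X\}$. *)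

(* Defs.v *)
From HB Require Import structures.
From mathcomp Require Import all_boot all_order all_algebra.
From mathcomp Require Import complex.
From mathcomp Require Import all_classical all_reals all_analysis.

Set Implicit Arguments.
Unset Strict Implicit.
Unset Printing Implicit Defensive.

Import Order.TTheory GRing.Theory Num.Theory.
Import numFieldNormedType.Exports.

Local Open Scope classical_set_scope.
Local Open Scope ring_scope.

Variant scalar_kind := RealScalars | ComplexScalars.

Definition scalars (R : realType) (k : scalar_kind) : numFieldType :=
  match k with
  | RealScalars => (R : numFieldType)
  | ComplexScalars => (R[i] : numFieldType)
  end.

Definition reS (R : realType) (k : scalar_kind) : scalars R k -> R :=
  match k return scalars R k -> R with
  | RealScalars => fun z => z
  | ComplexScalars => fun z => complex.Re z
  end.

Definition ofR (R : realType) (k : scalar_kind) : R -> scalars R k :=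
  match k return R -> scalars R k with
  | RealScalars => fun t => t
  | ComplexScalars => fun t => real_complex R t
  end.
Arguments ofR {R k} t.

Section scalars_lemmas.
Context (R : realType) (k : scalar_kind).
Implicit Types a b : scalars R k.

Lemma reSD a b : reS (a + b) = reS a + reS b.
Proof. by case: k a b => //= -[? ?] [? ?]. Qed.

Lemma reS_le a b : a <= b -> reS a <= reS b.
Proof. by case: k a b => //= a b; rewrite lecE => /andP[]. Qed.

Lemma reS_eq0 a : 0 <= a -> reS a = 0 -> a = 0.
Proof.
case: k a => //= a; rewrite lecE => /andP[/eqP + _].
by case: a => /= x y -> ->.
Qed.

Lemma reS0 : reS (0 : scalars R k) = 0.
Proof. by case: k. Qed.

End scalars_lemmas.

Section bounded_operators.
Context (R : realType) (k : scalar_kind).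
Implicit Types X Y : normedModType (scalars R k).

(* Bounded linear operators; the dual of X is blin X (scalars R k)^o. *)
Record blin X Y := Blin {
  bfun :> X -> Y ;
  bfun_linear : linear bfun ;
  bfun_continuous : continuous bfun }.

(* Norms are scalars, hence the real part. *)
Definition opnorm X Y (T : X -> Y) : R :=
  sup [set reS `|T x| | x in [set x : X | `|x| <= 1]].

Definition opdist X Y (S T : blin X Y) : R := opnorm (S \- T).

HB.instance Definition _ X Y (T : blin X Y) :=
  @GRing.isLinear.Build _ X Y _ (bfun T) (bfun_linear T).

HB.instance Definition _ X Y := gen_eqMixin (blin X Y).
HB.instance Definition _ X Y := gen_choiceMixin (blin X Y).

Section metric.
Context {X Y : normedModType (scalars R k)}.
Implicit Types S T U : blin X Y.

Lemma blin_ext S T : S =1 T -> S = T.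
Proof.
case: S T => [S Sl Sc] [T Tl Tc] /= /funext ST; rewrite ST in Sl Sc *.
by congr Blin; exact: Prop_irrelevance.
Qed.

Lemma blin_unit_ball_bound T :
  exists M, forall x : X, `|x| <= 1 -> `|T x| <= M.
Proof.
have /linear_bounded_continuous/bounded_funP : continuous T.
  exact: bfun_continuous.
exact.
Qed.

Lemma opdist_has_sup S T :
  has_sup [set reS `|(S \- T) x| | x in [set x : X | `|x| <= 1]].
Proof.
split; first by exists (reS `|(S \- T) 0|), 0 => //=; rewrite normr0 ler01.
have [M SM] := blin_unit_ball_bound S; have [N TN] := blin_unit_ball_bound T.
exists (reS (M + N)) => _ [x /= x1 <-]; apply: reS_le.
by rewrite (le_trans (ler_normB _ _))// lerD ?SM ?TN.
Qed.

Lemma opdist_ub S T (x : X) : `|x| <= 1 -> reS `|S x - T x| <= opdist S T.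
Proof.
by move=> x1; apply: ub_le_sup; [have [] := opdist_has_sup S T|exists x].
Qed.

Lemma opdistxx T : opdist T T = 0.
Proof.
rewrite /opdist /opnorm [X in sup X](_ : _ = [set 0]) ?sup1//.
apply/seteqP; split => [_ [x _ <-]|_ ->] /=.
  by rewrite subrr normr0 reS0.
by exists 0; rewrite ?subrr normr0 ?reS0//= ler01.
Qed.

Lemma opdistC S T : opdist S T = opdist T S.
Proof.
by rewrite /opdist /opnorm; congr sup; apply: eq_imagel => x _ /=;
  rewrite distrC.
Qed.

Lemma opdist_triangle T S U : opdist S U <= opdist S T + opdist T U.
Proof.
apply: ge_sup; first by have [] := opdist_has_sup S U.
move=> _ [x /= x1 <-].
apply: (@le_trans _ _ (reS (`|S x - T x| + `|T x - U x|))).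
  by apply: reS_le; exact: ler_distD.
by rewrite reSD lerD// opdist_ub.
Qed.

Lemma opdist0_eq S T : opdist S T = 0 -> S = T.
Proof.
move=> ST0; apply: blin_ext => x.
have unitE (y : X) : `|y| <= 1 -> S y = T y.
  move=> y1; apply/eqP; rewrite -subr_eq0 -normr_eq0; apply/eqP.
  apply: reS_eq0 => //; apply/eqP; rewrite eq_le -{1}ST0 opdist_ub//=.
  by rewrite -(reS0 R k) reS_le.
have [->|x0] := eqVneq x 0; first by rewrite !linear0.
have /unitE : `|(`|x|^-1 *: x)| <= 1.
  by rewrite normrZ normfV normr_id mulVf// normr_eq0.
by rewrite !linearZ => /scalerI; apply; rewrite invr_eq0 normr_eq0.
Qed.

End metric.

HB.instance Definition _ X Y := @isMetric.Build R (blin X Y) (@opdist X Y)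
  opdistxx opdist0_eq opdistC opdist_triangle.

Fact id_linear X : linear (@id X).
Proof. by []. Qed.

Fact id_continuous X : continuous (@id X).
Proof. by move=> x; exact: cvg_id. Qed.

Definition blin_id X : blin X X := Blin (@id_linear X) (@id_continuous X).

Fact comp_linear X (S T : blin X X) : linear (S \o T).
Proof. by move=> a u v /=; rewrite !linearP. Qed.

Fact comp_continuous X (S T : blin X X) : continuous (S \o T).
Proof. by move=> x; apply: continuous_comp; exact: bfun_continuous. Qed.

Definition blin_comp X (S T : blin X X) : blin X X :=
  Blin (@comp_linear X S T) (@comp_continuous X S T).

End bounded_operators.

Section invariance.
Context (R : realType) (k : scalar_kind) (X : normedModType (scalars R k)).
Implicit Types (G : set (blin X X)) (f : X -> \bar R).

(* Compactness refers to the topology of the operator norm on blin X X. *)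
Record compact_isometry_group G : Prop := {
  cig_isometry : forall g, G g -> forall x, `|g x| = `|x| ;
  cig_onto : forall g, G g -> forall y, exists x, g x = y ;
  cig_id : G (blin_id X) ;
  cig_comp : forall g h, G g -> G h -> G (blin_comp g h) ;
  cig_inv : forall g, G g -> exists2 h, G h & cancel g h /\ cancel h g ;
  cig_compact : compact G }.

Definition fixed_points G : set X :=
  [set x | forall g, G g -> g x = x].

Definition invariant_dual G : set (blin X (scalars R k)^o) :=
  [set h | forall x g, G g -> h (g x) = h x].

Definition invariant_fun G f := forall x g, G g -> f (g x) = f x.

Definition Dom f : set X := [set x | (f x < +oo)%E].

Definition proper_fun f := (forall x, f x != -oo%E) /\ Dom f !=set0.

(* In \bar R, 0 * +oo = 0, so t = 0 and t = 1 impose nothing. *)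
Definition convex_fun f := forall (x y : X) (t : R), 0 <= t <= 1 ->
  (f (ofR t *: x + ofR (1 - t) *: y)%R <= t%:E * f x + (1 - t)%:E * f y)%E.

Definition diff_quotient f (x0 x : X) (t : R) : \bar R :=
  ((f (x0 + ofR t *: x)%R - f x0) * (t^-1)%:E)%E.

Definition right_dderiv f (x0 x : X) : \bar R :=
  lim (diff_quotient f x0 x t @[t --> 0^'+]).

Definition Gsubdifferential G f (x0 : X) : set (blin X (scalars R k)^o) :=
  [set h | invariant_dual G h /\
    forall x, ((reS (h (x - x0)))%:E <= f x - f x0)%E].

End invariance.

(* Main.v *)
Require Import Defs.
From HB Require Import structures.
From mathcomp Require Import all_boot all_order all_algebra.
From mathcomp Require Import finmap complex ring lra.
From mathcomp Require Import all_classical all_reals all_analysis.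
Import Order.TTheory GRing.Theory Num.Theory.
Import numFieldNormedType.Exports.

(** Choosing g_1, ..., g_n to be an eps-net of G of minimal size, Hall's
marriage theorem matches it with its translate g_1 h, ..., g_n h, so the mean A
of the g_i satisfies |A (h v) - A v| <= 2 eps |v| for every h in G. These means
replace the Haar measure of G. Let N be the space of all w with |A w| = O(eps);
it contains every h v - v. If x is fixed by G, averaging gives
d^+f(x0)(x + w) >= d^+f(x0)(x) for w in N, because d^+f(x0) is convex,
G-invariant and continuous. The Hahn-Banach theorem applied to
v |-> inf_(w in N) d^+f(x0)(v + w) then yields a real-linear functional below
d^+f(x0) that equals it at x and vanishes on N, hence is G-invariant. *)

Set Implicit Arguments.
Unset Strict Implicit.
Unset Printing Implicit Defensive.

(** * Hall's marriage theorem *)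

Section marriage.
Context (I T : finType).
Implicit Types (F : I -> {set T}) (J K : {set I}).

Definition hall_condition F := forall J, #|J| <= #|\bigcup_(i in J) F i|.

(* If removing x and removing y both break Hall's condition, witnessed by J and
   K, then i |: (J :|: K) and J :&: K cannot both satisfy it. *)
Lemma hall_shrink F i x y : hall_condition F ->
  x \in F i -> y \in F i -> x != y ->
  exists2 z, z \in F i &
    hall_condition (fun j => if j == i then F i :\ z else F j).
Proof.
move=> hF xF yF xy.
pose F' z := fun j => if j == i then F i :\ z else F j.
pose hallb z := [forall J : {set I}, #|J| <= #|\bigcup_(j in J) F' z j|].
have [/forallP hx|] := boolP (hallb x); first by exists x.
have [/forallP hy|] := boolP (hallb y); first by exists y.
pose U J := \bigcup_(j in J :\ i) F j.
(* Away from [i] the sets are unchanged, so a violating set contains [i]. Removing [i] from it costs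
   one element, which turns the strict inequality into [<=]. *)
have bad z : ~~ hallb z ->
    exists2 J : {set I}, i \notin J & #|U J :|: (F i :\ z)| <= #|J|.
  move=> /forallPn[J]; rewrite -ltnNge => JF.
  have iJ : i \in J.
    apply: contraTT (hF J) => iJ; rewrite -ltnNge.
    rewrite (eq_bigr (F' z)) // => j jJ; rewrite /F'.
    by case: eqP jJ iJ => // -> ->.
  exists (J :\ i); first by rewrite !inE eqxx.
  move: JF; rewrite (cardsD1 i J) iJ add1n ltnS; apply: leq_trans.
  apply: subset_leq_card; apply/fintype.subsetP => t; rewrite inE => /orP[|tF].
    case/bigcupP => j; rewrite !inE => /and3P[_ ji jJ] tF.
    by apply/bigcupP; exists j => //; rewrite /F' (negPf ji).
  by apply/bigcupP; exists i => //; rewrite /F' eqxx.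
move=> /bad[K iK Ky] /bad[J iJ Jx].
have UE (L : {set I}) : i \notin L -> U L = \bigcup_(j in L) F j.
  move=> iL; rewrite /U (_ : L :\ i = L)//; apply/finset.setDidPl.
  by rewrite disjoint_sym disjoints1.
have := leq_add Jx Ky; rewrite -cardsUI leqNgt => /negP[].
set A := _ :|: _; set B := _ :&: _.
have AE : \bigcup_(j in i |: (J :|: K)) F j \subset A.
  apply/bigcupsP => j; rewrite !inE => /or3P[/eqP->|jJ|jK].
  - apply/fintype.subsetP => t tF; rewrite !inE tF !andbT.
    have [->|tx] := eqVneq t x; last by rewrite !orbT.
    by rewrite xy !orbT.
  - rewrite /A UE//; apply/fintype.subsetP => t tF; rewrite !inE.
    by apply/orP; left; apply/orP; left; apply/bigcupP; exists j.
  - rewrite /A (UE K)//; apply/fintype.subsetP => t tF; rewrite !inE.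
    by apply/orP; right; apply/orP; left; apply/bigcupP; exists j.
have BE : \bigcup_(j in J :&: K) F j \subset B.
  apply/bigcupsP => j; rewrite !inE => /andP[jJ jK].
  rewrite /B !UE//; apply/fintype.subsetP => t tF; rewrite !inE.
  by apply/andP; split; apply/orP; left; apply/bigcupP; exists j.
rewrite -(cardsUI J K) -addSn; apply: leq_add.
  apply: leq_trans (subset_leq_card AE); apply: leq_trans (hF _).
  by rewrite cardsU1 !inE negb_or iJ iK.
by apply: leq_trans (subset_leq_card BE); exact: hF.
Qed.

(* Rado's argument: shrink the sets while preserving Hall's condition until
   all of them are singletons. *)
Theorem hall_marriage F : hall_condition F ->
  exists2 s : I -> T, injective s & forall i, s i \in F i.
Proof.
have [n] := ubnP (\sum_i #|F i|); elim: n F => // n IHn F.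
rewrite ltnS => Fn hF.
have F0 i : 0 < #|F i|.
  by have := hF [set i]; rewrite cards1 big_set1.
have [/fintype.existsP ex|small] := boolP [exists i, 1 < #|F i|].
  case: ex => i /card_gt1P[x [y [xF yF xy]]].
  have [z zF hF'] := hall_shrink hF xF yF xy.
  have [|s s_inj sF] := IHn _ _ hF'; last first.
    exists s => // j; have := sF j.
    by case: eqP => // ->; rewrite inE => /andP[].
  apply: leq_trans Fn; rewrite (bigD1 i)//= [X in _ < X](bigD1 i)//= eqxx.
  rewrite (cardsD1 z (F i)) zF add1n ltnS leq_add2l.
  by apply: leq_sum => j /negPf ->.
have F1 i : exists x, F i == [set x].
  suff /cards1P[x ->] : #|F i| == 1 by exists x.
  rewrite eqn_leq F0 andbT leqNgt.
  by apply: contra small => Fi; apply/fintype.existsP; exists i.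
pose s i := xchoose (F1 i).
have sE i : F i = [set s i] by apply/eqP; exact: (xchooseP (F1 i)).
exists s => [i j sij|i]; last by rewrite sE set11.
apply/eqP; apply: contraT => ij.
have := hF [set i; j]; rewrite cards2 ij finset.bigcup_setU !big_set1 !sE sij.
by rewrite finset.setUid cards1.
Qed.

End marriage.

Local Open Scope classical_set_scope.
Local Open Scope ring_scope.

(** * The Hahn-Banach theorem *)

Section hahn_banach.
Context (R : realType) (V : lmodType R).
Implicit Types (p q : V -> R) (S : V -> set R) (u v x : V).

Record sublinear q : Prop := {
  sublinearD : forall u v, q (u + v) <= q u + q v ;
  sublinearZ_le : forall t v, 0 <= t -> q (t *: v) <= t * q v }.

(** The pairs (v, r) with [S v r] form a convex cone lying over all of [V] and nonnegative above 0,
    so the infimum of each fibre is finite and sublinear in v. Slopes, chains in Zorn's lemma and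
    the mean-null space all yield such cones. *)
Record conic S : Prop := {
  conic_nonempty : forall v, S v !=set0 ;
  conicD : forall u v r s, S u r -> S v s -> S (u + v) (r + s) ;
  conicZ : forall t v r, 0 < t -> S v r -> S (t *: v) (t * r) ;
  conic00 : S 0 0 ;
  conic0_ge0 : forall r, S 0 r -> 0 <= r }.

(** If s lies above -v and r above v, then r + s lies above 0; hence -s is a lower bound. *)
Lemma conic_has_inf S v : conic S -> has_inf (S v).
Proof.
move=> cS; split; first exact: conic_nonempty.
have [s Ss] := conic_nonempty cS (- v).
exists (- s) => r Sr; rewrite -subr_ge0 opprK.
by apply: (conic0_ge0 cS); rewrite -(subrr v); exact: conicD.
Qed.

Lemma conic_inf_le S v r : conic S -> S v r -> inf (S v) <= r.
Proof. by move=> cS; apply: ge_inf; have [] := conic_has_inf v cS. Qed.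

Lemma conic_inf_ge S v b : conic S -> (forall r, S v r -> b <= r) ->
  b <= inf (S v).
Proof. by move=> cS; apply: lb_le_inf; exact: conic_nonempty. Qed.

Lemma conic_inf_sublinear S : conic S -> sublinear (fun v => inf (S v)).
Proof.
move=> cS; split=> [u v|t v].
  rewrite -lerBlDr; apply: conic_inf_ge => // r Sr.
  rewrite lerBlDr -lerBlDl; apply: conic_inf_ge => // s Ss.
  by rewrite lerBlDl; apply: conic_inf_le => //; exact: conicD.
rewrite le_eqVlt => /predU1P[<-|t0].
  by rewrite scale0r mul0r; apply: conic_inf_le => //; exact: conic00.
rewrite -ler_pdivrMl//; apply: conic_inf_ge => // r Sr.
by rewrite ler_pdivrMl//; apply: conic_inf_le => //; exact: conicZ.
Qed.

Lemma sublinear0 q : sublinear q -> q 0 = 0.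
Proof.
move=> sq; apply/eqP; rewrite eq_le; apply/andP; split.
  by have := sublinearZ_le sq 0 (lexx 0); rewrite scale0r mul0r.
by have := sublinearD sq 0 0; rewrite addr0 lerDl.
Qed.

Lemma sublinearZ q t v : sublinear q -> 0 <= t -> q (t *: v) = t * q v.
Proof.
move=> sq; rewrite le_eqVlt => /predU1P[<-|t0].
  by rewrite scale0r mul0r sublinear0.
apply/eqP; rewrite eq_le sublinearZ_le ?(ltW t0)//=.
rewrite -ler_pdivlMl// -{1}(scale1r v) -(mulVf (lt0r_neq0 t0)) -scalerA.
by rewrite sublinearZ_le// invr_ge0 ltW.
Qed.

(** For sublinear [q], the infimum over t >= 0 of q(v + t x) - t q(x) is a sublinear function below
    [q] whose value at -x is at most -q(x). *)
Definition slope_set q x v : set R :=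
  [set r | exists2 t, 0 <= t & q (v + t *: x) - t * q x <= r].

Lemma conic_slope_set q x : sublinear q -> conic (slope_set q x).
Proof.
move=> sq; split.
- by move=> v; exists (q (v + 0 *: x) - 0 * q x), 0.
- move=> u v r s [t t0 qr] [t' t'0 qs]; exists (t + t'); first exact: addr_ge0.
  have := sublinearD sq (u + t *: x) (v + t' *: x).
  rewrite addrACA -scalerDl mulrDl; lra.
- move=> a v r a0 [t t0 qr]; exists (a * t); first by rewrite mulr_ge0// ltW.
  rewrite -scalerA -scalerDr sublinearZ; [|by []|exact: ltW].
  by rewrite -mulrA -mulrBr ler_pM2l.
- by exists 0; rewrite // scale0r mul0r addr0 sublinear0 ?subrr.
- by move=> r [t t0]; rewrite add0r sublinearZ// subrr.
Qed.

(* Minimality forces inf (slope_set q v u) = q u, and q (u + v) - q v belongs to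
   that set. *)
Lemma minimal_sublinear_additive q : sublinear q ->
  (forall q', sublinear q' -> (forall v, q' v <= q v) -> q' = q) ->
  forall u v, q (u + v) = q u + q v.
Proof.
move=> sq qmin u v; apply/eqP; rewrite eq_le sublinearD//=.
have cS := conic_slope_set v sq.
have E := qmin _ (conic_inf_sublinear cS).
rewrite -[q u](_ : inf (slope_set q v u) = _).
  rewrite -lerBrDr; apply: conic_inf_le => //.
  by exists 1; rewrite // scale1r mul1r.
rewrite -[in RHS]E// => w; apply: conic_inf_le => //.
by exists 0; rewrite // scale0r mul0r addr0 subr0.
Qed.

(** Zorn's lemma for the reversed pointwise order; a nonempty chain is bounded by its pointwise
    infimum, an empty one by [p]. *)
Lemma minimal_sublinear p : sublinear p ->
  exists q, [/\ sublinear q, forall v, q v <= p v &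
    forall q', sublinear q' -> (forall v, q' v <= q v) -> q' = q].
Proof.
move=> sp.
pose P q := sublinear q /\ forall v, q v <= p v.
pose T := {q | P q}.
pose ge (q q' : T) := `[< forall v, sval q' v <= sval q v >].
have [||||q qmax] := @Zorn T ge.
- by move=> q; apply/asboolP.
- move=> a b c /asboolP ab /asboolP bc; apply/asboolP => v.
  exact: le_trans (bc v) (ab v).
- move=> [a Ha] [b Hb] /asboolP/= ab /asboolP/= ba; apply: eq_exist.
  by apply/funext => v; apply/eqP; rewrite eq_le ab ba.
- move=> A Atot.
  have [[a0 Aa0]|A0] := pselect (A !=set0); last first.
    have H : sublinear p /\ forall v, p v <= p v by [].
    by exists (exist P p H) => s As; exfalso; apply: A0; exists s.
  pose S v : set R := [set r | exists2 q : T, A q & sval q v <= r].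
  have cS : conic S.
    split.
    + by move=> v; exists (sval a0 v), a0.
    + move=> u v r s [a Aa ar] [b Ab bs].
      (* By totality of the chain, the smaller of the two functions witnesses both bounds. *)
      wlog ab : u v r s a b Aa Ab ar bs / ge a b.
        move=> W; case: (Atot _ _ Aa Ab) => ab.
          exact: (W _ _ _ _ _ _ Aa Ab ar bs ab).
        rewrite (addrC u) (addrC r).
        exact: (W _ _ _ _ _ _ Ab Aa bs ar ab).
      exists b => //; have [sb _] := svalP b.
      rewrite (le_trans (sublinearD sb _ _))// lerD//.
      by move/asboolP: ab => /(_ u) /le_trans; apply.
    + move=> t v r t0 [a Aa ar]; exists a => //; have [sa _] := svalP a.
      by rewrite sublinearZ; [rewrite ler_pM2l|by []|exact: ltW].
    + by exists a0; rewrite // sublinear0//; have [] := svalP a0.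
    + by move=> r [a Aa]; rewrite sublinear0//; have [] := svalP a.
  have H : sublinear (fun v => inf (S v)) /\ forall v, inf (S v) <= p v.
    split; first exact: conic_inf_sublinear.
    by move=> v; apply: conic_inf_le => //; exists a0; have [] := svalP a0.
  exists (exist P _ H) => s As; apply/asboolP => v /=.
  by apply: conic_inf_le => //; exists s.
have [sq qp] := svalP q; exists (sval q); split => // q' sq' q'q.
have H : sublinear q' /\ forall v, q' v <= p v.
  by split => // v; exact: le_trans (qp v).
have := qmax (exist P _ H); rewrite /ge /= => /(_ _)/(congr1 sval)/= <- //.
exact/asboolP.
Qed.

(** A minimal sublinear function below the infimum of [slope_set p x] is linear; it is at most -p(x)
    at -x, which forces equality at x. *)
Theorem hahn_banach p x : sublinear p -> exists l : V -> R,
  [/\ (forall u v, l (u + v) = l u + l v), (forall t v, l (t *: v) = t * l v),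
      forall v, l v <= p v & l x = p x].
Proof.
move=> sp; have cS := conic_slope_set x sp.
have [l [sl lS lmin]] := minimal_sublinear (conic_inf_sublinear cS).
have lD := minimal_sublinear_additive sl lmin.
have lN v : l (- v) = - l v.
  by apply/eqP; rewrite -addr_eq0 -lD addNr sublinear0.
have lp v : l v <= p v.
  apply: le_trans (lS v) _; apply: conic_inf_le => //.
  by exists 0; rewrite // scale0r mul0r addr0 subr0.
exists l; split => //.
  move=> t v; have [t0|t0] := leP 0 t; first exact: sublinearZ.
  by rewrite -[t]opprK scaleNr lN sublinearZ ?mulNr// oppr_ge0 ltW.
apply/eqP; rewrite eq_le lp/= -lerN2 -lN (le_trans (lS _))//.
apply: conic_inf_le => //; exists 1; rewrite // scale1r mul1r addNr.
by rewrite sublinear0// add0r.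
Qed.

End hahn_banach.

(** * Almost invariant means *)

Section isometry_groups.
Context (R : realType) (V : lmodType R) (n : V -> R) (G : set (V -> V)).
Implicit Types (v w x : V) (h k : V -> V) (e : R).

Record seminorm : Prop := {
  seminormD : forall v w, n (v + w) <= n v + n w ;
  seminormZ : forall t v, n (t *: v) = `|t| * n v }.

Record isometry_group : Prop := {
  igD : forall g, G g -> forall v w, g (v + w) = g v + g w ;
  igZ : forall g, G g -> forall t v, g (t *: v) = t *: g v ;
  ig_isometry : forall g, G g -> forall v, n (g v) = n v ;
  ig_id : G id ;
  ig_comp : forall g h, G g -> G h -> G (g \o h) ;
  ig_inv : forall h, G h -> exists2 k, G k & cancel k h }.

Definition close e h k := forall v, n (h v - k v) <= e * n v.

(** Indexing by a subset of a finite type makes the size of a net the cardinal [#|A|] and lets a net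
    be assembled from two copies of the same indices. *)
Definition net e (I : finType) (A : {set I}) (g : I -> V -> V) :=
  (forall i, i \in A -> G (g i)) /\
  forall h, G h -> exists2 i, i \in A & close e (g i) h.

Definition totally_bounded_isometries :=
  forall e, 0 < e -> exists (I : finType) (A : {set I}) g, net e A g.

Definition mean m (g : 'I_m -> V -> V) v := m%:R^-1 *: \sum_i g i v.

Definition almost_invariant e m (g : 'I_m -> V -> V) :=
  [/\ (0 < m)%N, forall i, G (g i) &
    forall h v, G h -> n (mean g (h v) - mean g v) <= e * n v].

Hypotheses (sn : seminorm) (iG : isometry_group).

Lemma seminorm0 : n 0 = 0.
Proof. by rewrite -(scale0r (0 : V)) seminormZ// normr0 mul0r. Qed.

Lemma seminormN v : n (- v) = n v.
Proof. by rewrite -scaleN1r seminormZ// normrN1 mul1r. Qed.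

Lemma seminorm_ge0 v : 0 <= n v.
Proof.
have := seminormD sn v (- v); rewrite subrr seminorm0 seminormN; lra.
Qed.

Lemma seminorm_sum (I : finType) (F : I -> V) :
  n (\sum_i F i) <= \sum_i n (F i).
Proof.
elim/big_ind2: _ => [|u r v s ur vs|//]; first by rewrite seminorm0.
by rewrite (le_trans (seminormD sn _ _))// lerD.
Qed.

Lemma minimal_net e : (exists (I : finType) (A : {set I}) g, net e A g) ->
  exists m (g : 'I_m -> V -> V), net e [set: 'I_m]%SET g /\
    forall (I : finType) (A : {set I}) g', net e A g' -> (m <= #|A|)%N.
Proof.
move=> [I [A [g Ag]]].
pose P m := `[< exists (I : finType) (A : {set I}) g, net e A g /\ #|A| = m >].
have exP : exists m, P m by exists #|A|; apply/asboolP; exists I, A, g.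
case: (ex_minnP exP) => m /asboolP[I' [A' [g' [[gG gc] Am]]]] mmin.
exists m; rewrite -Am; exists (g' \o enum_val); split.
  split=> [i _|u /gc[i iA iu]]; first by apply: gG; exact: enum_valP.
  by exists (enum_rank_in iA i); rewrite ?inE//= enum_rankK_in.
move=> J B g'' Bg; rewrite Am; apply: mmin; apply/asboolP.
by exists J, B, g''.
Qed.

(* Both g and its right translate by h are nets of minimal size, so Hall's
   condition holds for the relation "some u in G is close to g i \o h and to
   g j". *)
Lemma translate_matching e m (g : 'I_m -> V -> V) h : G h ->
  net e [set: 'I_m]%SET g ->
  (forall (I : finType) (A : {set I}) g', net e A g' -> (m <= #|A|)%N) ->
  exists2 s : 'I_m -> 'I_m, injective s &
    forall i v, n (g i (h v) - g (s i) v) <= (e + e) * n v.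
Proof.
move=> Gh [gG gc] mmin.
pose F i : {set 'I_m} :=
  [set j |
    `[< exists u : V -> V, close e (g i \o h) u /\ close e (g j) u >]]%SET.
have hF : hall_condition F.
  (* Trade the translates [g i \o h] with [i] in [J] for the [g j] with [j] in [B]. The family [g']
     is still a net, so minimality gives m <= (m - #|J|) + #|B|. *)
  move=> J; pose B := (\bigcup_(i in J) F i)%SET.
  pose A : {set 'I_m + 'I_m} := (inl @: (~: J) :|: inr @: B)%SET.
  pose g' (k : 'I_m + 'I_m) :=
    match k with inl i => g i \o h | inr j => g j end.
  have /mmin : net e A g'.
    split=> [[i|j] _|u Gu] /=.
    - by apply: ig_comp => //; apply: gG; rewrite inE.
    - by apply: gG; rewrite inE.
    have [k Gk hk] := ig_inv iG Gh.
    have [i _ iu] := gc _ (ig_comp iG Gu Gk).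
    have ihu : close e (g i \o h) u.
      (* So far [k] is only a right inverse of [h]; having a right inverse itself, it is also a left
         inverse. *)
      have [k' Gk' kk'] := ig_inv iG Gk.
      have kh : cancel h k by move=> v; rewrite -[v]kk' hk.
      by move=> v /=; have := iu (h v); rewrite /= kh (ig_isometry iG Gh).
    have [iJ|iJ] := boolP (i \in J); last first.
      by exists (inl i) => //; rewrite !inE mem_imset ?inE ?iJ// => ? ? [].
    have [j _ ju] := gc _ Gu.
    exists (inr j) => //; rewrite !inE; apply/orP; right.
    apply: imset_f; apply/bigcupP; exists i => //; rewrite inE; apply/asboolP.
    by exists u.
  move=> mA; have := leq_trans mA (leq_card_setU _ _).
  rewrite !card_imset => [|? ? []//|? ? []//].
  by rewrite -[m in (m <= _)%N]card_ord -(cardsC J) addnC leq_add2l.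
have [s sinj sF] := hall_marriage hF.
exists s => // i v; have := sF i; rewrite inE => /asboolP[u [iu su]].
rewrite -(subrKA (u v)) mulrDl (le_trans (seminormD sn _ _))//.
by rewrite lerD ?iu// -seminormN opprB su.
Qed.

(** The matching [s] is a permutation, so reindexing the mean by [s] pairs each [g i (h v)] with a
    nearby [g (s i) v]. The net is taken at scale [e / 2] because matching doubles the error. *)
Lemma almost_invariant_mean e : totally_bounded_isometries -> 0 < e ->
  exists m (g : 'I_m -> V -> V), almost_invariant e g.
Proof.
move=> tb e0; have e20 : 0 < e / 2 by rewrite divr_gt0.
have [m [g [[gG gc] mmin]]] := minimal_net (tb _ e20).
have m0 : (0 < m)%N.
  by have [i _ _] := gc _ (ig_id iG); exact: leq_ltn_trans (ltn_ord i).
exists m, g; split => // [i|h v Gh]; first by apply: gG; rewrite inE.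
have [s sinj sg] := translate_matching Gh (conj gG gc) mmin.
rewrite /mean [X in _ - _ *: X](reindex_inj sinj)/= -scalerBr -sumrB.
rewrite seminormZ// ger0_norm ?invr_ge0 ?ler0n// ler_pdivrMl ?ltr0n//.
apply: le_trans (seminorm_sum _) _.
rewrite (_ : m%:R * _ = \sum_(i < m) e * n v); last first.
  by rewrite sumr_const card_ord mulr_natl.
by apply: ler_sum => i _; have := sg i v; rewrite -splitr.
Qed.

End isometry_groups.

(** * Invariant supporting functionals *)

Section invariant_support.
Context (R : realType) (V : lmodType R) (n : V -> R) (G : set (V -> V)).
Context (E : V -> R -> Prop).
Implicit Types (u v w x : V) (a b r s t : R).

(* E plays the role of the epigraph of v |-> f (x0 + v) - f x0. *)
Record invariant_epigraph : Prop := {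
  epi_convex : forall v w a b t, 0 <= t <= 1 -> E v a -> E w b ->
    E (t *: v + (1 - t) *: w) (t * a + (1 - t) * b) ;
  epi00 : E 0 0 ;
  epi0_ge0 : forall a, E 0 a -> 0 <= a ;
  epi_invariant : forall g v a, G g -> E v a -> E (g v) a ;
  epi_near0 : exists2 d, 0 < d & forall v, n v < d -> E v 1 }.

Hypotheses (sn : seminorm n) (iG : isometry_group n G).
Hypotheses (tb : totally_bounded_isometries n G) (iE : invariant_epigraph).

(** For the epigraph of f at x0, these are the r that dominate some difference quotient in direction
    v; by convexity their infimum is d^+f(x0)(v). *)
Definition epi_cone v : set R :=
  [set r | exists2 t, 0 < t & E (t *: v) (t * r)].

Lemma epi_coneD u v r s : epi_cone u r -> epi_cone v s ->
  epi_cone (u + v) (r + s).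
Proof.
move=> [t t0 Eu] [t' t'0 Ev].
have tt0 : 0 < t + t' by rewrite addr_gt0.
(* At this scale u + v becomes the convex combination of t u and t' v with weights t' / (t + t') and
   t / (t + t'). *)
exists (t * t' / (t + t')); first by rewrite divr_gt0// mulr_gt0.
have h1 : 1 - t' / (t + t') = t / (t + t') by field; rewrite lt0r_neq0.
have := @epi_convex iE _ _ _ _ (t' / (t + t')) _ Eu Ev.
rewrite h1 !scalerA !mulrA scalerDr mulrDr.
have -> : t / (t + t') * t' = t * t' / (t + t') by rewrite mulrAC.
rewrite mulrAC (mulrC t' t); apply.
by rewrite divr_ge0 ?ler_pdivrMr ?mul1r ?lerDr ?ltW.
Qed.

Lemma epi_coneZ t v r : 0 < t -> epi_cone v r -> epi_cone (t *: v) (t * r).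
Proof.
move=> t0 [t' t'0 Ev]; exists (t' / t); first exact: divr_gt0.
by rewrite scalerA mulrA divfK ?lt0r_neq0.
Qed.

(** The ball of [epi_near0] scaled by [e]: when [n v < d * e], the vector v / e lies in it. *)
Lemma epi_cone_near0 : exists2 d, 0 < d &
  forall v e, n v < d * e -> epi_cone v e.
Proof.
have [d d0 Ed] := epi_near0 iE; exists d => // v e ve.
have e0 : 0 < e by rewrite -(pmulr_rgt0 _ d0) (le_lt_trans (seminorm_ge0 sn v)).
exists e^-1; first by rewrite invr_gt0.
rewrite mulVf ?lt0r_neq0//; apply: Ed.
by rewrite seminormZ// gtr0_norm ?invr_gt0// ltr_pdivrMl// mulrC.
Qed.

(** One constant serves all almost invariant means, so these vectors form a linear subspace without
    passing to a limit of means. *)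
Definition mean_null w := exists C, forall e m (g : 'I_m -> V -> V), 0 < e ->
  almost_invariant n G e g -> n (mean g w) <= e * C.

Lemma meanD m (g : 'I_m -> V -> V) v w : (forall i, G (g i)) ->
  mean g (v + w) = mean g v + mean g w.
Proof.
move=> gG; rewrite /mean -scalerDr -big_split/=.
by congr (_ *: _); apply: eq_bigr => i _; rewrite (igD iG).
Qed.

Lemma meanZ m (g : 'I_m -> V -> V) t v : (forall i, G (g i)) ->
  mean g (t *: v) = t *: mean g v.
Proof.
move=> gG; rewrite /mean scalerA mulrC -scalerA [X in _ = _ *: X]scaler_sumr.
by congr (_ *: _); apply: eq_bigr => i _; rewrite (igZ iG).
Qed.

Lemma mean_nullD v w : mean_null v -> mean_null w -> mean_null (v + w).
Proof.
move=> [C Cv] [D Dw]; exists (C + D) => e m g e0 ag; have [_ gG _] := ag.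
rewrite meanD// mulrDr (le_trans (seminormD sn _ _))//.
by rewrite lerD ?Cv ?Dw.
Qed.

Lemma mean_nullZ t v : mean_null v -> mean_null (t *: v).
Proof.
move=> [C Cv]; exists (`|t| * C) => e m g e0 ag; have [_ gG _] := ag.
by rewrite meanZ// seminormZ// mulrCA ler_wpM2l// Cv.
Qed.

Lemma mean_nullN v : mean_null v -> mean_null (- v).
Proof. by move=> /(mean_nullZ (-1)); rewrite scaleN1r. Qed.

Lemma mean_null0 : mean_null 0.
Proof.
exists 0 => e m g e0 [_ gG _]; rewrite mulr0 -(scale0r (0 : V)) meanZ//.
by rewrite scale0r seminorm0.
Qed.

Lemma mean_nullB h v : G h -> mean_null (h v - v).
Proof.
move=> Gh; exists (n v) => e m g e0 [_ gG ag].
by rewrite meanD// -scaleN1r meanZ// scaleN1r; exact: ag.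
Qed.

Lemma epi_avg m (F : 'I_m -> V) a : (0 < m)%N -> (forall i, E (F i) a) ->
  E (m%:R^-1 *: \sum_i F i) a.
Proof.
case: m F => // m; elim: m => [|m IHm] F _ EF.
  by rewrite big_ord1 invr1 scale1r.
rewrite big_ord_recr/= scalerDr.
(* The average of m + 2 terms combines the last term with the average of the others, the latter with
   weight (m + 1) / (m + 2). *)
have := @epi_convex iE _ _ _ _ (m.+1%:R / m.+2%:R) _
  (IHm (fun i => F (widen_ord (leqnSn _) i)) isT (fun i => EF _)) (EF ord_max).
have h : 1 - m.+1%:R / m.+2%:R = m.+2%:R^-1 :> R.
  rewrite -[X in X - _](@divff _ m.+2%:R) ?pnatr_eq0//.
  by rewrite -mulrBl -natrB// subSnn mul1r.
rewrite -mulrDl subrKC mul1r h scalerA mulrAC mulfV ?pnatr_eq0// mul1r.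
by apply; rewrite divr_ge0//= ler_pdivrMr// mul1r ler_nat.
Qed.

Lemma epi_mean m (g : 'I_m -> V -> V) v a : (0 < m)%N ->
  (forall i, G (g i)) -> E v a -> E (mean g v) a.
Proof.
by move=> m0 gG Ev; apply: epi_avg => // i; exact: (epi_invariant iE).
Qed.

Lemma mean_fixed m (g : 'I_m -> V -> V) x : (0 < m)%N ->
  (forall i, G (g i)) -> (forall h, G h -> h x = x) -> mean g x = x.
Proof.
move=> m0 gG fx; rewrite /mean (eq_bigr (fun=> x)) => [|i _]; last exact: fx.
rewrite sumr_const card_ord -[x *+ m]scaler_nat scalerA mulVf ?scale1r//.
by rewrite pnatr_eq0 -lt0n.
Qed.

(* Averaging over an almost invariant mean keeps x and makes w small. *)
Lemma epi_cone_fixed x w r e : (forall h, G h -> h x = x) -> mean_null w ->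
  epi_cone (x + w) r -> 0 < e -> epi_cone x (r + e).
Proof.
move=> fx [C Cw] [t t0 Et] e0; have [d d0 Ed] := epi_cone_near0.
(* Chosen so that [c * C < d * e] whatever the sign of [C]. *)
pose c := d * e / (`|C| + 1).
have C0 : 0 < `|C| + 1 by rewrite ltr_wpDl.
have c0 : 0 < c by rewrite divr_gt0// mulr_gt0.
have [m [g ag]] := almost_invariant_mean sn iG tb c0; have [m0 gG _] := ag.
rewrite -(addrK (mean g w) x); apply: epi_coneD.
  exists t => //; rewrite -{1}(mean_fixed m0 gG fx) -meanD// -meanZ//.
  exact: epi_mean.
apply: Ed; rewrite seminormN//; apply: le_lt_trans (Cw _ _ _ c0 ag) _.
rewrite /c -mulrA gtr_pMr ?mulr_gt0// ltr_pdivrMl// mulr1.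
by rewrite ltr_pwDr// ler_norm.
Qed.

Definition support_set v : set R :=
  [set r | exists2 w, mean_null w & epi_cone (v + w) r].

Lemma conic_support_set : conic support_set.
Proof.
split.
- move=> v; have [d d0 Ed] := epi_cone_near0.
  (* Any number above n(v) / d would do. *)
  exists (d^-1 * (n v + 1)), 0; first exact: mean_null0.
  by apply: Ed; rewrite addr0 mulrA mulfV ?lt0r_neq0// mul1r ltrDl.
- move=> u v r s [w Nw Ew] [z Nz Ez]; exists (w + z); first exact: mean_nullD.
  by rewrite addrACA; exact: epi_coneD.
- move=> t v r t0 [w Nw Ew]; exists (t *: w); first exact: mean_nullZ.
  by rewrite -scalerDr; exact: epi_coneZ.
- exists 0; first exact: mean_null0.
  by exists 1; rewrite ?mul1r ?scale1r ?addr0//; exact: (epi00 iE).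
(* Since 0 is fixed by [G], a mean-null w can be removed from 0 + w at arbitrarily small cost. *)
- move=> r [w Nw Ew]; apply/ler_addgt0Pr => e e0.
  have [|t t0] := epi_cone_fixed _ Nw Ew e0.
    by move=> h Gh; rewrite -(scale0r (0 : V)) (igZ iG)// !scale0r.
  by rewrite scaler0 => /(epi0_ge0 iE); rewrite pmulr_rge0.
Qed.

(** Being at most 0 on the mean-null space, [l] vanishes there and hence is invariant. The third and
    last clauses together say that [l x] is the infimum of [epi_cone x]. *)
Theorem invariant_support x : (forall h, G h -> h x = x) ->
  exists l : V -> R,
  [/\ (forall u v, l (u + v) = l u + l v), (forall t v, l (t *: v) = t * l v),
      forall v a, E v a -> l v <= a,
      forall h v, G h -> l (h v) = l v &
      forall e, 0 < e -> epi_cone x (l x + e)].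
Proof.
move=> fx; have cS := conic_support_set.
have [l [lD lZ lS lx]] := hahn_banach x (conic_inf_sublinear cS).
have l0 w : mean_null w -> l w <= 0.
  move=> Nw; apply: le_trans (lS w) _; apply: conic_inf_le => //.
  exists (- w); first exact: mean_nullN.
  by rewrite subrr; exists 1; rewrite ?mul1r ?scale1r//; exact: (epi00 iE).
have lN v : l (- v) = - l v by rewrite -scaleN1r lZ mulN1r.
exists l; split => //.
- move=> v a Ea; apply: le_trans (lS v) _; apply: conic_inf_le => //.
  exists 0; first exact: mean_null0.
  by exists 1; rewrite ?mul1r ?scale1r ?addr0.
- move=> h v Gh; apply/eqP; rewrite -subr_eq0 -lN -lD.
  have Nw := mean_nullB v Gh.
  by rewrite eq_le l0//= -oppr_le0 -lN l0//; exact: mean_nullN.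
- move=> e e0; have e20 : 0 < e / 2 by rewrite divr_gt0.
  have [r [w Nw Ew] re] := inf_adherent e20 (conic_has_inf x cS).
  (* As r is within e / 2 of the infimum [l x], the price [l x + e - r] for dropping [w] is
     positive. *)
  have := epi_cone_fixed fx Nw Ew (e := l x + e - r); rewrite subrKC; apply.
  by rewrite subr_gt0 lx (lt_le_trans re)// lerD2l; lra.
Qed.

End invariant_support.

(** * Real and complex scalars *)

Section scalar_embedding.
Context (R : realType) (k : scalar_kind).
Implicit Types (s t : R) (z : scalars R k).
Local Notation ofK := (@ofR R k).

Lemma ofRD s t : ofK (s + t) = ofK s + ofK t.
Proof. by case: k => //=; rewrite rmorphD. Qed.

Lemma ofRM s t : ofK (s * t) = ofK s * ofK t.
Proof. by case: k => //=; rewrite rmorphM. Qed.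

Lemma ofR1 : ofK 1 = 1.
Proof. by case: k. Qed.

Lemma ofR0 : ofK 0 = 0.
Proof. by case: k. Qed.

Lemma reSZ t z : reS (ofK t * z) = t * reS z.
Proof. by case: k z => //= -[a b] /=; rewrite mul0r subr0. Qed.

Lemma ler_ofR s t : (ofK s <= ofK t) = (s <= t).
Proof. by case: k => //=; rewrite lecR. Qed.

Lemma ltr_ofR s t : (ofK s < ofK t) = (s < t).
Proof. by case: k => //=; rewrite ltcR. Qed.

Lemma normr_ofR t : `|ofK t| = ofK `|t|.
Proof. by case: k => //=; rewrite normc_def/= expr0n/= addr0 sqrtr_sqr. Qed.

Lemma ge0_ofR z : 0 <= z -> ofK (reS z) = z.
Proof.
by case: k z => //= -[a b]; rewrite lecE/= => /andP[/eqP-> _].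
Qed.

End scalar_embedding.

Section restriction_of_scalars.
Context (R : realType) (k : scalar_kind).

(** A type synonym keeps the real module structure apart from the one over [scalars R k]. *)
Definition realified (X : lmodType (scalars R k)) : Type := X.

Context (X : lmodType (scalars R k)).

HB.instance Definition _ := GRing.Zmodule.on (realified X).

Definition real_scale (t : R) (v : realified X) : realified X :=
  (@ofR R k t : scalars R k) *: (v : X).

Fact real_scaleA s t v : real_scale s (real_scale t v) = real_scale (s * t) v.
Proof. by rewrite /real_scale scalerA ofRM. Qed.

Fact real_scale1 : left_id 1 real_scale.
Proof. by move=> v; rewrite /real_scale ofR1 scale1r. Qed.

Fact real_scaleDr : right_distributive real_scale +%R.
Proof. by move=> t u v; rewrite /real_scale scalerDr. Qed.

Fact real_scaleDl v : {morph real_scale^~ v : s t / s + t}.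
Proof. by move=> s t; rewrite /real_scale ofRD scalerDl. Qed.

HB.instance Definition _ := GRing.Zmodule_isLmodule.Build R (realified X)
  real_scaleA real_scale1 real_scaleDr real_scaleDl.

End restriction_of_scalars.

Section real_norm.
Context (R : realType) (k : scalar_kind) (X : normedModType (scalars R k)).
Implicit Types (u v x : X) (t : R).

Definition real_norm (v : realified X) : R := reS `|v : X|.

Lemma ofR_real_norm v : ofR (real_norm v) = `|v|.
Proof. exact: ge0_ofR. Qed.

Lemma seminorm_real_norm : seminorm real_norm.
Proof.
split=> [v w|t v]; rewrite /real_norm.
  by rewrite -reSD; apply: reS_le; exact: ler_normD.
by rewrite normrZ normr_ofR reSZ.
Qed.

Lemma nbhs_real_norm x (P : X -> Prop) : (\near x, P x) ->
  exists2 d, 0 < d & forall v, real_norm v < d -> P (x + v).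
Proof.
move=> /nbhs_normP[e /= e0 eP]; exists (reS e).
  by rewrite -(ltr_ofR k) ofR0 ge0_ofR// ltW.
move=> v ve; apply: eP => /=; rewrite opprD addNKr normrN.
by rewrite -ofR_real_norm -(ge0_ofR (ltW e0)) ltr_ofR.
Qed.

(* Multiplying v by the phase of h v turns h v into |h v|. *)
Lemma real_part_bound (h : {linear X -> (scalars R k)^o}) C :
  (forall v, reS (h v) <= C * real_norm v) ->
  forall v, `|h v| <= ofR C * `|v|.
Proof.
move=> hC v; have [h0|h0] := eqVneq (h v) 0.
  rewrite h0 normr0 -ofR_real_norm -ofRM -(ofR0 R k) ler_ofR.
  by rewrite -(reS0 R k) -h0; exact: hC.
pose z : scalars R k := `|h v| / h v.
have z1 : `|z| = 1.
  by rewrite normrM normfV normr_id mulfV// normr_eq0.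
have := hC (z *: v); rewrite linearZ/= /z /(_ *: _)/= divfK// => hv.
rewrite -ofR_real_norm -ofRM -[leLHS]ge0_ofR// ler_ofR (le_trans hv)//.
by rewrite /real_norm normrZ -/z z1 mul1r.
Qed.

Lemma real_part_eq0 (h : {linear X -> (scalars R k)^o}) :
  (forall v, reS (h v) = 0) -> forall v, h v = 0.
Proof.
move=> h0 v; apply/eqP; rewrite -normr_le0.
rewrite -(mul0r `|v|) -(ofR0 R k).
by apply: real_part_bound => w; rewrite h0 mul0r.
Qed.

End real_norm.

(** For complex scalars, h(v) = l(v) - i l(i v), which real linearity of [l] makes complex
    linear. *)
Lemma complexification (R : realType) (k : scalar_kind)
    (X : lmodType (scalars R k)) (l : realified X -> R) :
  (forall u v, l (u + v) = l u + l v) -> (forall t v, l (t *: v) = t * l v) ->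
  exists2 h : X -> (scalars R k)^o, linear h & forall v, reS (h v) = l v.
Proof.
case: k X l => X l lD lZ.
  by exists l => // a u v; rewrite lD [X in X + _]lZ.
exists (fun v => (l v +i* - l ('i%C *: (v : X)))%C) => // -[a b] u v.
have lZX t (w : X) : l (t%:C%C *: w) = t * l w by exact: lZ.
have lDX (w w' : X) : l (w + w') = l w + l w' by exact: lD.
have E : (a +i* b)%C = a%:C%C + b%:C%C * 'i%C :> R[i] by simpc.
have Ei : 'i%C * (a +i* b)%C = (- b)%:C%C + a%:C%C * 'i%C :> R[i] by simpc.
rewrite [LHS](_ : _ = (l ((a +i* b)%C *: u + v) +i*
  - l ('i%C *: ((a +i* b)%C *: u + v)))%C)//.
rewrite scalerDr scalerA Ei E !scalerDl -!scalerA !lDX !lZX.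
rewrite /(_ *: _)/=; simpc; congr (_ +i* _)%C; ring.
Qed.

(** * Groups of operators and subdifferentials *)

Section operator_groups.
Context (R : realType) (k : scalar_kind) (X : normedModType (scalars R k)).

HB.instance Definition _ := isPointed.Build (blin X X) (blin_id X).

Lemma opdist_bound (S T : blin X X) (v : X) :
  reS `|S v - T v| <= opdist S T * reS `|v|.
Proof.
have [->|v0] := eqVneq v 0; first by rewrite !linear0 addr0 normr0 reS0 mulr0.
have n0 : 0 < reS `|v| by rewrite -(ltr_ofR k) ofR0 ge0_ofR// normr_gt0.
rewrite -ler_pdivrMr// mulrC -[X in X * _]gtr0_norm ?invr_gt0//.
have w1 : `|(ofR (reS `|v|)^-1 *: v)| <= 1 :> scalars R k.
  rewrite normrZ normr_ofR gtr0_norm ?invr_gt0// -[X in _ * X]ge0_ofR//.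
  by rewrite -ofRM mulVf ?ofR1// lt0r_neq0.
have := opdist_ub S T w1.
by rewrite !linearZ/= -scalerDr normrZ normr_ofR reSZ.
Qed.

Definition operator_maps (G : set (blin X X)) :
    set (realified X -> realified X) :=
  [set (g : X -> X) | g in G].

Lemma operator_maps_isometry_group G : compact_isometry_group G ->
  isometry_group (@real_norm R k X) (operator_maps G).
Proof.
move=> hG; split.
- by move=> _ [g _ <-] v w; rewrite linearD.
- by move=> _ [g _ <-] t v; exact: linearZ.
- by move=> _ [g Gg <-] v; rewrite /real_norm (cig_isometry hG).
- by exists (blin_id X) => //; exact: cig_id.
- move=> _ _ [g Gg <-] [h Gh <-]; exists (blin_comp g h) => //.
  exact: (cig_comp hG).
- move=> _ [g Gg <-]; have [h Gh [gh hg]] := cig_inv hG Gg.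
  by exists h => //; exists h.
Qed.

(** Compactness extracts a finite subcover from the interiors of the e-balls centred in [G]; the
    centres form the net. *)
Lemma operator_maps_totally_bounded G : compact_isometry_group G ->
  totally_bounded_isometries (@real_norm R k X) (operator_maps G).
Proof.
move=> hG e e0; have := cig_compact hG; rewrite compact_cover.
move=> /(_ (blin X X) G (fun g => (ball g e)°)) [||D DG GD].
- by move=> g _; exact: open_interior.
- move=> g Gg; exists g => //; apply: nbhs_singleton; apply: nbhs_interior.
  exact: nbhsx_ballx.
exists D, [set: D]%SET, (fun i v => (val i : blin X X) v); split.
  move=> i _; exists (val i) => //.
  by have := DG _ (fsvalP i); rewrite inE.
move=> _ [h Gh <-]; have [g /= gD /interior_subset gh] := GD _ Gh.
exists [` gD]%fset; rewrite ?inE// => v /=.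
apply: le_trans (opdist_bound _ _ _) _.
apply: ler_wpM2r; last exact: ltW gh.
exact: (seminorm_ge0 (seminorm_real_norm X)).
Qed.

Lemma dual_of_real_part (l : realified X -> R) C :
  (forall u v, l (u + v) = l u + l v) -> (forall t v, l (t *: v) = t * l v) ->
  (forall v, l v <= C * real_norm v) ->
  exists H : blin X (scalars R k)^o, forall v, reS (H v) = l v.
Proof.
move=> lD lZ lC; have [h h_lin hl] := complexification lD lZ.
pose h' : {linear X -> (scalars R k)^o} :=
  HB.pack h (GRing.isLinear.Build _ _ _ _ h h_lin).
have hC : forall v, `|h' v| <= ofR `|C| * `|v|.
  apply: real_part_bound => v; rewrite hl (le_trans (lC v))//.
  apply: ler_wpM2r; last exact: ler_norm.
  exact: (seminorm_ge0 (seminorm_real_norm X)).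
suff hc : continuous h by exists (Blin h_lin hc).
apply/(linear_bounded_continuous h')/bounded_funP => r.
exists (ofR `|C| * r) => v vr; rewrite (le_trans (hC v))// ler_wpM2l//.
by rewrite -(ofR0 R k) ler_ofR.
Qed.

(** A functional with vanishing real part is zero; this applies to [H \o g] minus [H]. *)
Lemma dual_invariant (G : set (blin X X)) (H : blin X (scalars R k)^o) :
  (forall g v, G g -> reS (H (g v)) = reS (H v)) -> invariant_dual G H.
Proof.
move=> HG v g Gg; apply/eqP; rewrite -subr_eq0; apply/eqP.
pose D : {linear X -> (scalars R k)^o} := (H \o g) \- H.
apply: (real_part_eq0 (h := D)) => w.
by apply: (addIr (reS (H w))); rewrite -reSD add0r subrK HG.
Qed.

End operator_groups.

(** * Epigraph and difference quotients at a point *)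

Section epigraph.
Context (R : realType) (k : scalar_kind) (X : normedModType (scalars R k)).
Variables (G : set (blin X X)) (f : X -> \bar R) (x0 : X).

Definition epi_at (v : realified X) (a : R) :=
  (f (x0 + (v : X))%R <= f x0 + a%:E)%E.

Hypotheses (f_proper : proper_fun f) (x0_dom : Dom f x0).

Lemma Dom_fin_num : f x0 \is a fin_num.
Proof. by rewrite fin_numE (proj1 f_proper)/= lt_eqF. Qed.

Lemma epi_at_convex v w a b t : convex_fun f -> 0 <= t <= 1 ->
  epi_at v a -> epi_at w b ->
  epi_at (t *: v + (1 - t) *: w) (t * a + (1 - t) * b).
Proof.
move=> f_convex t01; have /andP[t0 t1] := t01.
rewrite /epi_at -(fineK Dom_fin_num) => va wb.
have := f_convex (x0 + (v : X)) (x0 + (w : X)) t t01.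
rewrite !scalerDr addrACA -scalerDl -ofRD subrKC ofR1 scale1r => /le_trans.
apply.
rewrite (_ : (_ + (t * a + (1 - t) * b)%:E = t%:E * ((fine (f x0))%:E + a%:E) +
  (1 - t)%:E * ((fine (f x0))%:E + b%:E))%E); last first.
  by rewrite -!EFinD; congr EFin; ring.
by apply: leeD; apply: lee_wpmul2l => //; rewrite lee_fin// subr_ge0.
Qed.

Lemma invariant_epigraph_at : convex_fun f -> invariant_fun G f ->
  fixed_points G x0 -> {for x0, continuous f} ->
  invariant_epigraph (@real_norm R k X) (operator_maps G) epi_at.
Proof.
move=> f_convex f_inv x0_fixed f_cont; have ff := Dom_fin_num; split.
- by move=> *; exact: epi_at_convex.
- by rewrite /epi_at !addr0.
- by move=> a; rewrite /epi_at addr0 -[leLHS]adde0 leeD2lE// lee_fin.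
- move=> _ v a [g Gg <-]; rewrite /epi_at.
  have <- : g (x0 + (v : X)) = x0 + g v.
    by rewrite linearD; congr (_ + _)%R; exact: x0_fixed.
  by rewrite f_inv.
- have /nbhs_real_norm[d d0 Hd] : \forall y \near x0, (f y < f x0 + 1)%E.
  apply: (f_cont [set y | (y < f x0 + 1)%E]); apply: open_ereal_lt'.
  by rewrite lteDl// lte_fin.
  exists d => // v /Hd; exact: ltW.
Qed.

Lemma diff_quotient_le (x : X) t a : 0 < t ->
  (diff_quotient f x0 x t <= a%:E)%E <->
  epi_at (t *: (x : realified X)) (t * a).
Proof.
move=> t0; rewrite /diff_quotient lee_pdivrMr// leeBlDl ?Dom_fin_num//.
by rewrite -EFinM (mulrC a).
Qed.

(** If y = -oo, then b - 1 would be an upper bound of y, which is absurd. This reduces inequalities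
    in [\bar R] to real heights of the epigraph. *)
Lemma lee_of_upper_bounds b (y : \bar R) :
  (forall a, (y <= a%:E)%E -> b <= a) -> (b%:E <= y)%E.
Proof.
case: y => [r||] yb; rewrite ?leey//; first by rewrite lee_fin yb.
by have := yb (b - 1) (leNye _); rewrite lerDl oppr_ge0 ler10.
Qed.

(** Difference quotients are nondecreasing in t: s v is the convex combination of t v and 0 with
    weight s / t on t v. *)
Lemma epi_at_shrink v a s t : convex_fun f -> 0 < s <= t ->
  epi_at (t *: v) (t * a) -> epi_at (s *: v) (s * a).
Proof.
move=> f_convex /andP[s0 st] Et; have t0 := lt_le_trans s0 st.
have E0 : epi_at 0 0 by rewrite /epi_at !addr0.
have := @epi_at_convex _ _ _ _ (s / t) f_convex _ Et E0.
rewrite scaler0 mulr0 !addr0 scalerA mulrA divfK ?lt0r_neq0//; apply.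
by rewrite ler_pdivrMr// mul1r st divr_ge0 ?(ltW s0) ?(ltW t0).
Qed.

(** The last two hypotheses make [b] the infimum of the difference quotients, and monotonicity turns
    the infimum into the limit at 0 from the right. *)
Lemma cvg_diff_quotient (x : X) (b : R) : convex_fun f ->
  (forall t a, 0 < t -> epi_at (t *: (x : realified X)) (t * a) -> b <= a) ->
  (forall e, 0 < e -> epi_cone epi_at x (b + e)) ->
  diff_quotient f x0 x t @[t --> 0^'+] --> b%:E.
Proof.
move=> f_convex lb ub.
have lbq t : 0 < t -> (b%:E <= diff_quotient f x0 x t)%E.
  move=> t0; apply: lee_of_upper_bounds => a /(diff_quotient_le _ _ t0).
  exact: lb.
have ubq e : 0 < e -> \forall t \near 0^'+,
    0 < t /\ (diff_quotient f x0 x t <= (b + e)%:E)%E.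
  move=> /ub[t0 t00 Et0]; near=> t.
  have t_gt0 : 0 < t by near: t; exact: nbhs_right_gt.
  split => //; apply/diff_quotient_le => //; apply: epi_at_shrink Et0 => //.
  by rewrite t_gt0; near: t; exact: nbhs_right_ltW.
(* Although f may take the value +oo, these quotients lie between b and b + e, so convergence can be
   checked in the reals. *)
have fin t e : 0 < t /\ (diff_quotient f x0 x t <= (b + e)%:E)%E ->
    diff_quotient f x0 x t \is a fin_num.
  move=> [t_gt0 qe]; rewrite fin_real//.
  by rewrite (lt_le_trans (ltNyr b) (lbq _ t_gt0)) (le_lt_trans qe (ltry _)).
apply/fine_cvgP; split; first by apply: filterS (ubq 1 ltr01) => t /fin.
apply/cvgrPdist_le => e e0; apply: filterS (ubq e e0) => t te.
have := fin _ _ te; case: te => t_gt0 + /fineK qfin /=.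
have := lbq _ t_gt0; rewrite -qfin !lee_fin => bq qe.
by rewrite distrC ger0_norm ?subr_ge0// lerBlDl.
Unshelve. all: by end_near. Qed.

(** Put v = y - x0 and test on real heights; this is the form in which [invariant_support] bounds
    its functional. *)
Lemma GsubdifferentialP (h : blin X (scalars R k)^o) :
  Gsubdifferential G f x0 h <->
  invariant_dual G h /\ forall v a, epi_at v a -> reS (h v) <= a.
Proof.
split=> -[Gh hf]; split => //.
  move=> v a va; rewrite -lee_fin -[v](addKr x0) addrC.
  by apply: le_trans (hf _) _; rewrite leeBlDl ?Dom_fin_num.
move=> y; apply: lee_of_upper_bounds => a ya; apply: hf.
by rewrite /epi_at [(x0 + _)%R]subrKC -leeBlDl ?Dom_fin_num.
Qed.

End epigraph.

(** * The directional derivative as an attained supremum *)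

Unset Implicit Arguments.

Theorem proposition25 (R : realType) (k : scalar_kind)
    (X : completeNormedModType (scalars R k)) (G : set (blin X X))
    (f : X -> \bar R) (x0 : X)
    (hG : compact_isometry_group G)
    (f_proper : proper_fun f) (f_convex : convex_fun f)
    (f_inv : invariant_fun G f)
    (x0_dom : Dom f x0) (x0_fixed : fixed_points G x0)
    (f_cont : {for x0, continuous f}) :
  forall x : X, fixed_points G x ->
    [/\ cvg (diff_quotient f x0 x t @[t --> 0^'+]),
        right_dderiv f x0 x =
          ereal_sup [set (reS (h x))%:E | h in Gsubdifferential G f x0] &
        exists2 h, Gsubdifferential G f x0 h &
          (reS (h x))%:E =
            ereal_sup [set (reS (h' x))%:E | h' in Gsubdifferential G f x0]].
Proof.
move=> x x_fixed.
have sn := seminorm_real_norm X.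
have iG := operator_maps_isometry_group hG.
have tb := operator_maps_totally_bounded hG.
have iE := invariant_epigraph_at f_proper x0_dom f_convex f_inv x0_fixed f_cont.
have [_ [g Gg <-]|l [lD lZ lE lG lx]] := invariant_support (x := x) sn iG tb iE.
  exact: x_fixed.
have lcone v a : epi_cone (epi_at f x0) v a -> l v <= a.
  by move=> [t t0 /lE]; rewrite lZ ler_pM2l.
(* Continuity of f at x0 bounds [l v] by the norm of v divided by [d], which makes the functional
   continuous. *)
have [d d0 Ed] := epi_cone_near0 sn iE.
have [|H Hl] := dual_of_real_part (C := d^-1) lD lZ.
  move=> v; apply/ler_addgt0Pr => e e0; apply/lcone/Ed.
  by rewrite mulrDr mulVKf ?lt0r_neq0// ltrDl mulr_gt0.
have HG : Gsubdifferential G f x0 H.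
  apply/(GsubdifferentialP G f_proper x0_dom); split.
    by apply: dual_invariant => g v Gg; rewrite !Hl; apply: lG; exists g.
  by move=> v a /lE; rewrite Hl.
have supE : ereal_sup [set (reS (h x))%:E | h in Gsubdifferential G f x0] =
    (l x)%:E.
  apply/eqP; rewrite eq_le; apply/andP; split; last first.
    by apply: ereal_sup_ubound; exists H; rewrite ?Hl.
  (* The real part of a subgradient at x is below every difference quotient in direction x, and some
     quotient is at most [l x + e]. *)
  apply: ge_ereal_sup => _ [h /(GsubdifferentialP G f_proper x0_dom)[_ hE] <-].
  rewrite lee_fin; apply/ler_addgt0Pr => e /lx[t t0 /hE].
  by rewrite linearZ/= reSZ ler_pM2l.
have qx : diff_quotient f x0 x t @[t --> 0^'+] --> (l x)%:E.
  apply: cvg_diff_quotient => // t a t0 Et.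
  by apply: lcone; exists t.
split; first by apply/cvg_ex; exists (l x)%:E.
  by rewrite supE; exact: cvg_lim qx.
by exists H; rewrite ?supE ?Hl.
Qed.
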